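(* Let $\mathcal X$ be an asymptotically CAT(0) space all of whose balls are finite, and consider the topology on $\bar{\mathcal X}=\mathcal X\cup\mathfrak B\mathcal X$ induced by the balls of the weak metric $d_\kappa$. Then $\bar{\mathcal X}$ is compact, Hausdorff and metrizable, and the $G$-action on $\mathcal X$ extends continuously to $\bar{\mathcal X}$, where $G=\mathrm{Isom}(\mathcal X)$. Moreover, for any radius $R>0$ and any open cover $\mathcal U$ of $\bar{\mathcal X}$, all but finitely many balls in $\mathcal X$ of radius $R$ are $\mathcal U$-small (i.e. contained in some element of $\mathcal U$).
   Context: **Asymptotically CAT(0) spaces.** A $(1,C)$-quasi-geodesic in a metric space $(X,d)$ joining $x$ to $y$ is a (not necessarily continuous) map $\gamma:[0,a]\to X$ with $\gamma(0)=x$, $\gamma(a)=y$ and $|s-t|-C\le d(\gamma(s),\gamma(t))\le |s-t|+C$ for all $s,t$; it is discrete if the domain is instead $\{0,1,\dots,a\}$. A triangle $\Delta$ of $(1,C)$-quasi-geodesics consists of three points $x,y,z$ (vertices) and (possibly discrete) $(1,C)$-quasi-geodesics (sides) joining them pairwise; let $\bar x,\bar y,\bar z$ be the vertices of a comparison triangle in $\mathbb E^2$ (same pairwise distances). If $p$ lies on the side joining $x,y$, a comparison point for $p$ is a point $\bar p\in[\bar x,\bar y]$ with $|d(p,x)-d(\bar p,\bar x)|\le C$, and $\delta(p)=\min\{d(x,p),d(p,y)\}-C$; similarly for the other sides. Given a non-decreasing sublinear function $\kappa:\mathbb R\to[0,\infty)$ (i.e. $\kappa(t)/t\to0$ as $t\to\infty$),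 $\Delta$ satisfies the CAT(0) condition up to $\kappa$ if for all $p,q$ on $\Delta$ with comparison points $\bar p,\bar q$ one has $d(p,q)\le d(\bar p,\bar q)+\kappa(\delta(p))+\kappa(\delta(q))$. $(X,d)$ is asymptotically CAT(0) with parameters $C>0$, $\kappa$ if any two points of $X$ are joined by a $(1,C)$-quasi-geodesic and every triangle of $(1,C)$-quasi-geodesics satisfies the CAT(0) condition up to $\kappa$. **Boundary.** Parameters $C,\kappa$ for $\mathcal X$ are fixed so that moreover any two points of $\mathcal X$ are joined by a discrete $(1,C)$-quasi-geodesic. A segment is a discrete $(1,C)$-quasi-geodesic; a ray is a map $\gamma:\mathbb Z_{\ge0}\to\mathcal X$ satisfying the $(1,C)$-quasi-geodesic inequalities. Two rays $\gamma_1,\gamma_2$ are equivalent if $t\mapsto d(\gamma_1(t),\gamma_2(t))$ is sublinear; $\mathfrak B\mathcal X$ is the set of equivalence classes of rays. Fix a basepoint $\mathfrak o\in\mathcal X$. Every class contains rays starting at $\mathfrak o$, so a point of $\mathfrak B\mathcal X$ is identified with its set of representative rays starting at $\mathfrak o$; a point $p\in\mathcal X$ is identified with the set of all segments from $\mathfrak o$ to $p$. For $A,B\in\bar{\mathcal X}$ let $d_\kappa(A,B)=0$ if $A=B$ and otherwise $$d_\kappa(A,B)=\inf_{\alpha\in A,\beta\in B}\frac{1}{\sup\{t\mid d(\alpha(t),\beta(t))\le3\kappa(t)\}},$$ the supremum being over integers $t\ge0$ for which $\alpha(t)$ and $\beta(t)$ are both defined (with $1/0=\infty$, $1/\infty=0$).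 A set $U\subseteq\bar{\mathcal X}$ is open if for every $x\in U$ there is $R>0$ with $\{y: d_\kappa(x,y)<R\}\subseteq U$. *)

(* Defs.v *)
From HB Require Import structures.
From mathcomp Require Import all_boot all_order all_algebra.
From mathcomp Require Import all_classical all_reals all_analysis.

Set Implicit Arguments.
Unset Strict Implicit.
Unset Printing Implicit Defensive.

Import Order.TTheory GRing.Theory Num.Theory.
Import numFieldTopology.Exports numFieldNormedType.Exports.

Local Open Scope classical_set_scope.
Local Open Scope ring_scope.

Section EuclideanPlane.
Context {R : realType}.
Implicit Types u v w : 'rV[R]_2.

(* The norm provided by the library on row vectors is the sup norm. *)
Definition edist u v : R := Num.sqrt (\sum_i (u ord0 i - v ord0 i) ^+ 2).

Definition esegment u v : set 'rV[R]_2 :=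
  [set u + t *: (v - u) | t in `[0, 1]%classic].

End EuclideanPlane.

Section AsymptoticallyCAT0.
Context {R : realType} {X : metricType R}.
Implicit Types (C a : R) (kappa : R -> R) (x y z p q : X).

(* [D] is the domain and [tau] reads a parameter as a real number: the
   identity for intervals of R, the cast of nat into R for discrete domains. *)
Definition quasi_geodesic_on C (I : Type) (tau : I -> R) (D : set I)
    (gamma : I -> X) :=
  forall s t, D s -> D t ->
    `|tau s - tau t| - C <= mdist (gamma s) (gamma t) <= `|tau s - tau t| + C.

Definition quasi_geodesic C a (gamma : R -> X) x y :=
  [/\ 0 <= a, gamma 0 = x, gamma a = y &
      quasi_geodesic_on C id `[0, a]%classic gamma].

Definition is_segment C (n : nat) (gamma : nat -> X) x y :=
  [/\ gamma 0%N = x, gamma n = y &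
      quasi_geodesic_on C (fun k => k%:R) `I_n.+1 gamma].

Definition is_ray C (gamma : nat -> X) :=
  quasi_geodesic_on C (fun k => k%:R) setT gamma.

(* The CAT(0) condition only refers to the points lying on a side, so a side is
   recorded by its image [S]. *)
Definition is_side C x y (S : set X) :=
  (exists a gamma, quasi_geodesic C a gamma x y /\ S = gamma @` `[0, a]%classic)
  \/ (exists n gamma, is_segment C n gamma x y /\ S = gamma @` `I_n.+1).

Definition is_triangle C x y z (Sxy Syz Sxz : set X) :=
  [/\ is_side C x y Sxy, is_side C y z Syz & is_side C x z Sxz].

Definition comparison_triangle x y z (x' y' z' : 'rV[R]_2) :=
  [/\ edist x' y' = mdist x y, edist y' z' = mdist y z &
      edist x' z' = mdist x z].

Definition comparison_point C x (x' y' : 'rV[R]_2) p (p' : 'rV[R]_2) :=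
  esegment x' y' p' /\ `|mdist p x - edist p' x'| <= C.

Definition side_depth C x y p : R := Num.min (mdist x p) (mdist p y) - C.

(* [p'] is a comparison point for [p], and [dp] the value of delta(p), when [p]
   is regarded as a point of one of the sides. Comparison points on a side are
   located from the endpoint named first. Vertices may be relabelled and sides
   reversed, so for two points on different sides all choices of endpoints are
   covered once every triangle is considered. *)
Definition triangle_point C x y z (Sxy Syz Sxz : set X) (x' y' z' : 'rV[R]_2)
    p (p' : 'rV[R]_2) (dp : R) :=
  [\/ [/\ Sxy p, comparison_point C x x' y' p p' & dp = side_depth C x y p],
      [/\ Syz p, comparison_point C y y' z' p p' & dp = side_depth C y z p] |
      [/\ Sxz p, comparison_point C x x' z' p p' & dp = side_depth C x z p]].

Definition CAT0_up_to C kappa x y z (Sxy Syz Sxz : set X) :=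
  forall x' y' z' : 'rV[R]_2, comparison_triangle x y z x' y' z' ->
  forall (p : X) (p' : 'rV[R]_2) (dp : R) (q : X) (q' : 'rV[R]_2) (dq : R),
    triangle_point C x y z Sxy Syz Sxz x' y' z' p p' dp ->
    triangle_point C x y z Sxy Syz Sxz x' y' z' q q' dq ->
    mdist p q <= edist p' q' + kappa dp + kappa dq.

End AsymptoticallyCAT0.

Definition sublinear_gauge {R : realType} (kappa : R -> R) :=
  [/\ forall t, 0 <= kappa t, {homo kappa : s t / s <= t} &
      kappa t / t @[t --> +oo] --> 0].

Definition asymptotically_CAT0 {R : realType} (X : metricType R) (C : R)
    (kappa : R -> R) :=
  [/\ 0 < C, sublinear_gauge kappa,
      forall x y : X, exists a gamma, quasi_geodesic C a gamma x y &
      forall (x y z : X) (Sxy Syz Sxz : set X),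
        is_triangle C x y z Sxy Syz Sxz ->
        CAT0_up_to C kappa x y z Sxy Syz Sxz].

Definition discretely_joined {R : realType} (X : metricType R) (C : R) :=
  forall x y : X, exists n gamma, is_segment C n gamma x y.

Section Boundary.
Context {R : realType} (X : metricType R).

Definition ray_equiv (gamma1 gamma2 : nat -> X) :=
  mdist (gamma1 t) (gamma2 t) / t%:R @[t --> \oo] --> (0 : R).

Definition ray_class (C : R) (gamma : nat -> X) : set (nat -> X) :=
  [set gamma' | is_ray C gamma' /\ ray_equiv gamma gamma'].

Definition ray_classes (C : R) : set (set (nat -> X)) :=
  [set ray_class C gamma | gamma in [set gamma | is_ray C gamma]].

Definition boundary (C : R) : Type := set_type (ray_classes C).

HB.instance Definition _ C := Choice.on (boundary C).

End Boundary.

(* The parameters [kappa] and [o] do not affect the underlying set, only the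
   topology declared below. *)
Definition bordification {R : realType} (X : metricType R) (C : R)
  (kappa : R -> R) (o : X) : Type := (X + boundary X C)%type.

HB.instance Definition _ (R : realType) (X : metricType R) (C : R)
    (kappa : R -> R) (o : X) :=
  Choice.copy (bordification C kappa o) (X + boundary X C)%type.

Section WeakMetric.
Context {R : realType} {X : metricType R}.
Variables (C : R) (kappa : R -> R) (o : X).

Local Notation Xbar := (bordification C kappa o).

Definition interior_point (x : X) : Xbar := inl x.

(* A segment of length n is (Some n, gamma), where the values of gamma beyond n
   are irrelevant; a ray is (None, gamma). *)
Definition partial_path : Type := (option nat * (nat -> X))%type.

Definition partial_path_dom (alpha : partial_path) : set nat :=
  if alpha.1 is Some n then `I_n.+1 else setT.

Definition representatives (A : Xbar) : set partial_path :=
  match A with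
  | inl p => [set alpha | exists2 n, alpha.1 = Some n &
                          is_segment C n alpha.2 o p]
  | inr xi => [set alpha | [/\ alpha.1 = None, alpha.2 0%N = o &
                             set_val xi alpha.2]]
  end.

Definition agreement (alpha beta : partial_path) : \bar R :=
  ereal_sup [set (t%:R)%:E | t in
    [set t | [/\ partial_path_dom alpha t, partial_path_dom beta t &
                 mdist (alpha.2 t) (beta.2 t) <= 3 * kappa t%:R]]].

(* In [\bar R], 0^-1 = +oo and +oo^-1 = 0. *)
Definition dkappa (A B : Xbar) : \bar R :=
  if A == B then 0%E
  else ereal_inf [set ((agreement alpha beta)^-1)%E
                 | alpha in representatives A & beta in representatives B].

Definition dkappa_ball (A : Xbar) (r : R) : set Xbar :=
  [set B | (dkappa A B < r%:E)%E].

Definition dkappa_open (U : set Xbar) : Prop :=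
  forall A, U A -> exists2 r : R, 0 < r & dkappa_ball A r `<=` U.

Lemma dkappa_openT : dkappa_open setT.
Proof. by move=> A _; exists 1. Qed.

Lemma dkappa_openI : setI_closed dkappa_open.
Proof.
move=> U V oU oV A [UA VA].
have [r r0 rU] := oU A UA; have [s s0 sV] := oV A VA.
exists (Num.min r s); first by rewrite lt_min r0.
move=> B; rewrite /dkappa_ball /= EFin_min lt_min => /andP[Br Bs].
by split; [exact: rU | exact: sV].
Qed.

Lemma dkappa_open_bigU (I : Type) (f : I -> set Xbar) :
  (forall i, dkappa_open (f i)) -> dkappa_open (\bigcup_i f i).
Proof.
move=> of_ A [i _ fA]; have [r r0 rf] := of_ i A fA.
by exists r => // B /rf fB; exists i.
Qed.

HB.instance Definition _ := isOpenTopological.Build Xbar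
  dkappa_openT dkappa_openI dkappa_open_bigU.

End WeakMetric.

Definition metrizable (R : realType) (T : topologicalType) :=
  exists d : T -> T -> R,
    [/\ forall x y, d x y = 0 <-> x = y,
        forall x y, d x y = d y x,
        forall x y z, d x z <= d x y + d y z &
        forall U : set T, open U <->
          forall x, U x -> exists2 r : R, 0 < r & [set y | d x y < r] `<=` U].

Definition isometries {R : realType} (X : metricType R) : set (X -> X) :=
  [set g | bijective g /\ forall x y, mdist (g x) (g y) = mdist x y].

Arguments isometries {R} X _.

(* There is an action of Isom(X) by homeomorphisms of the bordification that
   restricts to the given action on X. *)
Definition isometries_extend {R : realType} (X : metricType R) (C : R)
    (kappa : R -> R) (o : X) :=
  exists Phi : (X -> X) -> bordification C kappa o -> bordification C kappa o,
    [/\ Phi id = id,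
        forall g h, isometries X g -> isometries X h ->
          Phi (g \o h) = Phi g \o Phi h,
        forall g, isometries X g -> continuous (Phi g) &
        forall g x, isometries X g ->
          Phi g (interior_point C kappa o x) = interior_point C kappa o (g x)].

Definition open_cover (T : topologicalType) (UU : set (set T)) :=
  UU `<=` open /\ \bigcup_(U in UU) U = setT.

Definition cover_small (T : Type) (UU : set (set T)) (B : set T) :=
  exists2 U, UU U & B `<=` U.

Definition interior_balls {R : realType} (X : metricType R) (C : R)
    (kappa : R -> R) (o : X) (r : R) : set (set (bordification C kappa o)) :=
  [set interior_point C kappa o @` ball x r | x in setT].

Arguments interior_balls {R X} C kappa o r _.

(* Main.v *)
(** The CAT(0) condition controls two paths issuing from a common point, or
    ending at a common point, by Euclidean comparison plus [2 kappa(s)]. As kappa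
    is sublinear, if two paths from the basepoint are at distance at most
    [K kappa(u) + M] at a sufficiently late time [u], they are within
    [3 kappa(s)] of each other at a given earlier time [s]. Hence the relations
    "agreeing up to kappa at some time at least [n]" form a countable base of a
    separated uniform structure that induces the topology of the balls of
    d_kappa, which is therefore metrizable and Hausdorff. Finiteness of balls
    lets one take the pointwise limit of segments along an ultrafilter: this
    gives compactness, and also representatives of every boundary class at any
    basepoint. An isometry distorts the paths from the basepoint by a bounded
    amount after rebasing, which agreement at late times absorbs. Finally, balls
    of fixed radius far from the basepoint are small for the uniform structure,
    and the Lebesgue number of a cover concludes. *)

Require Import Defs.
From HB Require Import structures.
From mathcomp Require Import all_boot all_order all_algebra.
From mathcomp Require Import all_classical all_reals all_analysis.
From mathcomp Require Import lra.

Set Implicit Arguments.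
Unset Strict Implicit.
Unset Printing Implicit Defensive.

Import Order.TTheory GRing.Theory Num.Theory.
Import numFieldTopology.Exports numFieldNormedType.Exports.

Local Open Scope classical_set_scope.
Local Open Scope ring_scope.

(** * Metrization of a Hausdorff space with a countable base of entourages *)

Section Metrization.
Context {R : realType}.

(** Only the balls are given, so the distance is the infimum of the admissible radii. Truncation at
    1 keeps every set of radii non-empty and leaves balls of radius at most 1 unchanged. *)
Lemma pseudometric_metrizable (T : pseudoMetricType R) :
  hausdorff_space T -> metrizable R T.
Proof.
move=> hT.
pose D (x y : T) := [set e : R | 0 < e /\ (ball x e y \/ 1 <= e)].
have D0 x y : lbound (D x y) 0 by move=> e [/ltW].
have D1 x y : D x y !=set0 by exists 1; split=> //; right.
pose d x y := inf (D x y).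
have d0 x y : 0 <= d x y by exact: lb_le_inf.
have ltd x y e : d x y < e -> e <= 1 -> ball x e y.
  move=> de e1; have [e' [e'0 [xy|e'1]] e'e] := inf_lt (D1 x y) de.
    exact: le_ball (ltW e'e) _ xy.
  by have := lt_le_trans e'e e1; rewrite ltNge e'1.
have dlt x y e : D x y e -> d x y <= e by apply: ge_inf; exists 0.
have dsym x y : d x y = d y x.
  have DC u v : D u v `<=` D v u.
    by move=> e [e0 [/ball_sym uv|e1]]; split=> //; [left | right].
  by rewrite /d; congr inf; apply/seteqP; split; exact: DC.
exists d; split=> //.
- move=> x y; split=> [dxy|<-]; last first.
    apply/eqP; rewrite eq_le d0 andbT; apply/ler_addgt0Pr => e e0.
    by rewrite add0r; apply: dlt; split=> //; left; exact: ballxx.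
  move: (hT); rewrite ball_hausdorff => sep; apply/eqP/negPn/negP => /sep.
  move=> [[r s] /= /eqP rs0]; have : set0 y; last by [].
  rewrite -rs0; split; last exact: ballxx.
  apply: (@le_ball _ _ _ (Num.min r%:num 1)); first by rewrite ge_min lexx.
  by apply: ltd; rewrite ?dxy ?lt_min ?ltr01 ?andbT ?ge_min ?lexx ?orbT.
- move=> x y z; apply/ler_addgt0Pr => e e0.
  have e20 : 0 < e / 2 by rewrite divr_gt0.
  have near_d u v : exists2 e', D u v e' & e' < d u v + e / 2.
    by apply: inf_lt => //; rewrite ltrDl.
  have [a [a0 Da] ad] := near_d x y; have [b [b0 Db] bd] := near_d y z.
  apply: (@le_trans _ _ (a + b)); last by lra.
  apply: dlt; split; first by lra.
  case: Da => [xya|]; last by right; lra.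
  case: Db => [yzb|]; last by right; lra.
  by left; exact: ball_triangle xya yzb.
- move=> U; rewrite openE; split=> [oU x /oU /nbhs_ballP[e /= e0 eU]|oU x /oU].
    exists (Num.min e 1); first by rewrite lt_min e0 ltr01.
    move=> y /= dy; apply: eU; apply: (@le_ball _ _ _ (Num.min e 1)).
      by rewrite ge_min lexx.
    by apply: ltd => //; rewrite ge_min lexx orbT.
  move=> [r r0 rU]; apply/nbhs_ballP; exists (r / 2); first by rewrite /= divr_gt0.
  move=> y xy; apply: rU => /=; apply: (@le_lt_trans _ _ (r / 2)); last by lra.
  by apply: dlt; split; [rewrite divr_gt0 | left].
Qed.

(** The relations generate a uniformity with a countable base, and such a uniformity comes from a
    pseudometric. *)
Lemma metrizable_of_countable_base (T : topologicalType)
    (V : nat -> T -> T -> Prop) :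
  (forall n x, V n x x) ->
  (forall n x y, V n x y -> V n y x) ->
  (forall m n x y, (m <= n)%N -> V n x y -> V m x y) ->
  (forall n, exists m, forall x y z, V m x y -> V m y z -> V n x z) ->
  (forall x (W : set T), nbhs x W <-> exists n, [set y | V n x y] `<=` W) ->
  hausdorff_space T -> metrizable R T.
Proof.
move=> Vxx Vsym Vdec Vcomp Vnbhs hT.
pose ent := filter_from setT (fun n => [set xy : T * T | V n xy.1 xy.2]).
have entF : Filter ent.
  apply: filter_from_filter; first by exists 0%N.
  move=> i j _ _; exists (maxn i j) => // xy /= Vxy.
  by split; [apply: Vdec (leq_maxl i j) _ | apply: Vdec (leq_maxr i j) _].
have ent_diag A : ent A -> diagonal `<=` A.
  by move=> [n _ nA] [x y] xy; apply: nA => /=; rewrite (xy : x = y).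
have ent_inv A : ent A -> ent (A^-1)%relation.
  by move=> [n _ nA]; exists n => // -[x y] /= /Vsym xy; apply: nA.
have ent_split A : ent A -> exists2 B, ent B & (B \; B `<=` A)%relation.
  move=> [n _ nA]; have [m mn] := Vcomp n.
  exists [set xy : T * T | V m xy.1 xy.2]; first by exists m.
  by move=> [x z] [y /= xy yz]; apply: nA; exact: mn xy yz.
have entN : @nbhs T T = nbhs_ ent.
  apply/funext => x; apply/seteqP; split=> W.
    move=> /Vnbhs[n nW]; exists [set xy : T * T | V n xy.1 xy.2]; first by exists n.
    by move=> y; rewrite /xsection/= inE/=; exact: nW.
  move=> [A [n _ nA] AW]; apply/Vnbhs; exists n => y xy; apply: AW.
  by rewrite /xsection/= inE; exact: nA.
pose mixin := @Nbhs_isUniform_mixin.Build T ent entF ent_diag ent_inv ent_split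
  entN.
(* [U] is [T] with this uniformity over its own topology, so the result obtained for [U] at the end
   is about [T] by conversion. *)
pose U : uniformType := HB.pack_for uniformType T mixin.
have cU : countable_uniformity U.
  apply/countable_uniformityP.
  exists (fun n => [set xy : U * U | V n xy.1 xy.2]); last by move=> n; exists n.
  by move=> A [n _ nA]; exists n.
exact: (@pseudometric_metrizable (@countable_uniform.type U cU)).
Qed.

End Metrization.

Local Notation edist := Defs.edist.

(** * Euclidean plane: comparison points and comparison triangles *)

Section EuclideanPlane.
Context {R : realType}.
Implicit Types (u v w P Q A B : 'rV[R]_2) (s t : R).

Lemma edistE u v : edist u v =
  Num.sqrt ((u ord0 ord0 - v ord0 ord0) ^+ 2 +
            (u ord0 ord_max - v ord0 ord_max) ^+ 2).
Proof.
rewrite /edist big_ord_recl big_ord1.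
by rewrite (_ : lift ord0 ord0 = ord_max)//; exact/val_inj.
Qed.

Lemma edist_ge0 u v : 0 <= edist u v. Proof. exact: sqrtr_ge0. Qed.

Lemma edistC u v : edist u v = edist v u.
Proof. by rewrite !edistE -sqrrN opprB -[in X in _ + X]sqrrN opprB. Qed.

Lemma edistxx u : edist u u = 0.
Proof. by rewrite edistE !subrr expr0n addr0 sqrtr0. Qed.

Lemma edist_translate u v : edist u v = edist (u - v) 0.
Proof. by rewrite !edistE !mxE !subr0. Qed.

Lemma edistZ t u : edist (t *: u) 0 = `|t| * edist u 0.
Proof.
rewrite !edistE !mxE !subr0 !exprMn -mulrDr sqrtrM ?sqr_ge0//.
by rewrite sqrtr_sqr.
Qed.

Lemma edistD u v : edist (u + v) 0 <= edist u 0 + edist v 0.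
Proof.
rewrite !edistE !mxE !subr0.
move: (u ord0 ord0) (u ord0 ord_max) (v ord0 ord0) (v ord0 ord_max) => a b c d.
set p := Num.sqrt _ + _.
have p0 : 0 <= p by rewrite addr_ge0 ?sqrtr_ge0.
rewrite -(ger0_norm p0) -sqrtr_sqr.
rewrite ler_wsqrtr// /p [leRHS]sqrrD !sqr_sqrtr ?addr_ge0 ?sqr_ge0//.
have cs : a * c + b * d <= Num.sqrt (a ^+ 2 + b ^+ 2) * Num.sqrt (c ^+ 2 + d ^+ 2).
  rewrite -sqrtrM ?addr_ge0 ?sqr_ge0//; apply: le_trans (ler_norm _) _.
  rewrite -sqrtr_sqr ler_wsqrtr// -subr_ge0.
  (* Lagrange's identity, which yields Cauchy-Schwarz. *)
  have -> : (a ^+ 2 + b ^+ 2) * (c ^+ 2 + d ^+ 2) - (a * c + b * d) ^+ 2 =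
            (a * d - b * c) ^+ 2 by lra.
  exact: sqr_ge0.
rewrite mulr2n; lra.
Qed.

Lemma edist_triangle v u w : edist u w <= edist u v + edist v w.
Proof.
rewrite edist_translate (edist_translate u) (edist_translate v).
by rewrite (_ : u - w = (u - v) + (v - w)) ?edistD// addrA subrK.
Qed.

(** The point at distance [s] from [P] towards [A]; when [P = A] the division by zero gives 0 and
    the point is [P]. *)
Definition epoint (s : R) P A : 'rV[R]_2 := P + (s / edist P A) *: (A - P).

Lemma epoint_segment s P A : 0 <= s <= edist P A -> esegment P A (epoint s P A).
Proof.
move=> /andP[s0 sP]; exists (s / edist P A) => //=; rewrite in_itv/=.
rewrite divr_ge0 ?edist_ge0//=.
have [->|P0] := eqVneq (edist P A) 0; first by rewrite invr0 mulr0.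
have {}P0 : 0 < edist P A by rewrite lt_neqAle eq_sym P0 edist_ge0.
by rewrite ler_pdivrMr ?mul1r.
Qed.

Lemma edist_epoint s P A : 0 <= s <= edist P A -> edist (epoint s P A) P = s.
Proof.
move=> /andP[s0 sP]; rewrite edist_translate /epoint addrC addKr edistZ.
rewrite -edist_translate (edistC A) ger0_norm ?divr_ge0 ?edist_ge0//.
have [P0|P0] := eqVneq (edist P A) 0; last by rewrite divfK.
by rewrite P0 mulr0; apply/eqP; rewrite eq_sym eq_le s0 andbT -P0.
Qed.

(** The case [P = Q] serves paths with a common start, the case [A = B] paths with a common end. *)
Lemma edist_epoint2 s P Q A B : 0 <= s -> s <= edist P A -> s <= edist Q B ->
  edist (epoint s P A) (epoint s Q B) <=
    2 * edist P Q + 2 * (s / edist P A * edist A B).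
Proof.
move=> s0 sP sQ.
have [PA0|PA0] := eqVneq (edist P A) 0.
  have -> : s = 0 by apply/eqP; rewrite eq_le s0 andbT -PA0.
  rewrite /epoint !mul0r !scale0r !addr0 mulr0 addr0.
  by have := edist_ge0 P Q; lra.
have [QB0|QB0] := eqVneq (edist Q B) 0.
  have -> : s = 0 by apply/eqP; rewrite eq_le s0 andbT -QB0.
  rewrite /epoint !mul0r !scale0r !addr0 mulr0 addr0.
  by have := edist_ge0 P Q; lra.
set t := s / _.
have [t0 t1] : 0 <= t /\ t <= 1.
  have a0 : 0 < edist P A by rewrite lt_neqAle eq_sym PA0 edist_ge0.
  by rewrite /t divr_ge0 ?edist_ge0// ler_pdivrMr ?mul1r.
(* Both points are written with the same ratio [t]; the third term corrects for the different ratio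
   on the second segment. *)
have -> : edist (epoint s P A) (epoint s Q B) =
    edist ((1 - t) *: (P - Q) + t *: (A - B) + (t - s / edist Q B) *: (B - Q)) 0.
  rewrite edist_translate; congr edist; rewrite /epoint -/t.
  by apply/rowP => i; rewrite !mxE; lra.
apply: le_trans (edistD _ _) _; apply: le_trans (lerD (edistD _ _) (lexx _)) _.
rewrite !edistZ -!edist_translate (edistC B) (ger0_norm t0).
have -> : `|1 - t| = 1 - t by rewrite ger0_norm ?subr_ge0.
(* Since [s = t * edist P A], the correction has norm [t] times the difference of the two lengths,
   which the triangle inequality controls. *)
have -> : `|t - s / edist Q B| * edist Q B = t * `|edist Q B - edist P A|.
  rewrite -{2}(ger0_norm t0) -[X in _ * X = _](ger0_norm (edist_ge0 Q B)) -!normrM.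
  by rewrite mulrBl divfK// mulrBr [t * edist P A]divfK.
have : `|edist Q B - edist P A| <= edist P Q + edist A B.
  rewrite ler_norml; apply/andP; split.
    have := edist_triangle Q P A; have := edist_triangle B Q A.
    by rewrite (edistC B A); lra.
  by have := edist_triangle P Q B; have := edist_triangle A P B;
    rewrite (edistC Q P); lra.
move=> /(ler_wpM2l t0); have := edist_ge0 P Q.
by lra.
Qed.

End EuclideanPlane.

(** Put [x'] at the origin and [y'] on the first axis. The law of cosines gives the abscissa [u] of
    [z'], and the triangle inequalities give [|u| <= c], so that the height [v] exists. *)
Lemma comparison_triangle_ex {R : realType} {X : metricType R} (x y z : X) :
  exists x' y' z' : 'rV[R]_2, comparison_triangle x y z x' y' z'.
Proof.
pose pt (a b : R) : 'rV[R]_2 := \row_i (if i == ord0 then a else b).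
have ptE a b c d : edist (pt a b) (pt c d) = Num.sqrt ((a - c) ^+ 2 + (b - d) ^+ 2).
  by rewrite edistE !mxE.
have sqrtE (a b : R) : 0 <= b -> a = b ^+ 2 -> Num.sqrt a = b.
  by move=> b0 ->; rewrite sqrtr_sqr ger0_norm.
have a0 := mdist_ge0 x y; have b0 := mdist_ge0 y z; have c0 := mdist_ge0 x z.
have abc : mdist x y <= mdist x z + mdist y z.
  by rewrite (metric_sym y z) metric_triangle.
have bac : mdist y z <= mdist x y + mdist x z.
  by rewrite (metric_sym x y) metric_triangle.
have cab := metric_triangle x y z.
rewrite /comparison_triangle.
move: (mdist x y) (mdist y z) (mdist x z) a0 b0 c0 abc bac cab => a b c.
move=> a0 b0 c0 abc bac cab.
have [az|an0] := eqVneq a 0.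
  have -> : b = c by lra.
  rewrite az; exists (pt 0 0), (pt 0 0), (pt c 0).
  by rewrite !ptE; split; apply: sqrtE => //; lra.
pose u := (a ^+ 2 + c ^+ 2 - b ^+ 2) / (2 * a).
have uE : 2 * a * u = a ^+ 2 + c ^+ 2 - b ^+ 2.
  by rewrite /u mulrC divfK// mulf_neq0.
have {an0}a0 : 0 < a by rewrite lt_neqAle eq_sym an0.
have v0 : 0 <= c ^+ 2 - u ^+ 2.
  have h1 : u <= c.
    by rewrite -(@ler_pM2l _ (2 * a)) ?mulr_gt0// uE; nra.
  have h2 : - c <= u.
    by rewrite -(@ler_pM2l _ (2 * a)) ?mulr_gt0// uE; nra.
  by nra.
have sv := sqr_sqrtr v0; set v := Num.sqrt _ in sv.
by exists (pt 0 0), (pt a 0), (pt u v); rewrite !ptE; split; apply: sqrtE => //; lra.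
Qed.

(** * CAT(0) comparison of two segments sharing an endpoint *)

Section Comparison.
Context {R : realType} {X : metricType R} (C : R) (kappa : R -> R).
Context (hX : asymptotically_CAT0 X C kappa) (hC : discretely_joined X C).
Implicit Types (a b : R) (x y z : X) (alpha beta : nat -> X) (m n s t u : nat).

Lemma asymptotic_constant_gt0 : 0 < C. Proof. by have [] := hX. Qed.
Local Notation C_gt0 := asymptotic_constant_gt0.

Lemma gauge_ge0 a : 0 <= kappa a. Proof. by have [_ [k0 _ _] _ _] := hX. Qed.

Lemma gauge_le a b : a <= b -> kappa a <= kappa b.
Proof. by have [_ [_ km _] _ _] := hX; exact: km. Qed.

Lemma segment_sub n m alpha x y : is_segment C n alpha x y -> (m <= n)%N ->
  is_segment C m alpha x (alpha m).
Proof.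
move=> [a0 an qg] mn; split=> // s t /= sm tm.
by apply: qg => /=; rewrite ltnS (leq_trans _ mn).
Qed.

Lemma segment_dist_start n alpha x y s : is_segment C n alpha x y -> (s <= n)%N ->
  s%:R - C <= mdist x (alpha s) <= s%:R + C.
Proof.
move=> [a0 an qg] sn; have := qg 0%N s; rewrite a0 /= sub0r normrN normr_nat.
by apply.
Qed.

Lemma segment_length n alpha x y : is_segment C n alpha x y ->
  n%:R - C <= mdist x y <= n%:R + C.
Proof.
by move=> sg; have [_ an _] := sg; have := segment_dist_start sg (leqnn n);
  rewrite an.
Qed.

(** The [- C] in the depth cancels the additive error of the segment, so the CAT(0) defect at time
    [s] is at most [kappa s%:R]. *)
Lemma side_depth_le n alpha x y s : is_segment C n alpha x y -> (s <= n)%N ->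
  side_depth C x y (alpha s) <= s%:R.
Proof.
move=> sg /(segment_dist_start sg)/andP[_ sC].
by rewrite /side_depth lerBlDr ge_min sC.
Qed.

Lemma segment_side n alpha x y : is_segment C n alpha x y ->
  is_side C x y (alpha @` `I_n.+1).
Proof. by move=> sg; right; exists n, alpha. Qed.

(** Comparison points tolerate an error [C], so the parameter [s] can replace the true distance:
    points at equal times on two sides get comparison points at equal distances. *)
Lemma segment_comparison n alpha x y s (x' y' : 'rV[R]_2) :
  is_segment C n alpha x y -> (s <= n)%N -> edist x' y' = mdist x y ->
  s%:R <= mdist x y ->
  comparison_point C x x' y' (alpha s) (epoint s%:R x' y').
Proof.
move=> sg sn xy sxy.
have s0 : 0 <= (s%:R : R) <= edist x' y' by rewrite xy ler0n.
split; first exact: epoint_segment.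
have := segment_dist_start sg sn; rewrite edist_epoint// metric_sym ler_norml.
by move=> /andP[? ?]; apply/andP; split; lra.
Qed.

(** The triangle is closed by any segment from [y] to [z]. Each path contributes a defect
    [kappa s%:R]; the last term is the Euclidean bound for two sides leaving one vertex. *)
Lemma fan_dist n m alpha beta x y z s :
  is_segment C n alpha x y -> is_segment C m beta x z ->
  (s <= n)%N -> (s <= m)%N -> s%:R <= mdist x y -> s%:R <= mdist x z ->
  mdist (alpha s) (beta s) <=
    2 * kappa s%:R + 2 * (s%:R / mdist x y * mdist y z).
Proof.
move=> sa sb sn sm sy sz; have [k [gamma sg]] := hC y z.
have [x' [y' [z' tri]]] := comparison_triangle_ex x y z.
have [xy yz xz] := tri.
have [_ _ _ cat0] := hX.
have cat := cat0 x y z _ _ _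
  (And3 (segment_side sa) (segment_side sg) (segment_side sb)).
have pa : triangle_point C x y z (alpha @` `I_n.+1) (gamma @` `I_k.+1)
    (beta @` `I_m.+1) x' y' z' (alpha s) (epoint s%:R x' y')
    (side_depth C x y (alpha s)).
  by constructor 1; split; [exists s | exact: segment_comparison sa _ _ _ | ].
have pb : triangle_point C x y z (alpha @` `I_n.+1) (gamma @` `I_k.+1)
    (beta @` `I_m.+1) x' y' z' (beta s) (epoint s%:R x' z')
    (side_depth C x z (beta s)).
  by constructor 3; split; [exists s | exact: segment_comparison sb _ _ _ | ].
have := cat _ _ _ tri _ _ _ _ _ _ pa pb.
have := gauge_le (side_depth_le sa sn); have := gauge_le (side_depth_le sb sm).
have := @edist_epoint2 _ s%:R x' x' y' z' (ler0n _ _).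
rewrite xy xz yz edistxx.
by move=> /(_ sy sz); lra.
Qed.

(** Times are counted from the two distinct starts. The Euclidean term depends neither on [s] nor on
    the lengths, so the bound survives when the common end goes to infinity. *)
Lemma cofan_dist n m alpha beta x y z s :
  is_segment C n alpha x z -> is_segment C m beta y z ->
  (s <= n)%N -> (s <= m)%N -> s%:R <= mdist x z -> s%:R <= mdist y z ->
  mdist (alpha s) (beta s) <= 2 * kappa s%:R + 2 * mdist x y.
Proof.
move=> sa sb sn sm sy sz; have [k [gamma sg]] := hC x y.
have [x' [y' [z' tri]]] := comparison_triangle_ex x y z.
have [xy yz xz] := tri.
have [_ _ _ cat0] := hX.
have cat := cat0 x y z _ _ _
  (And3 (segment_side sg) (segment_side sb) (segment_side sa)).
have pa : triangle_point C x y z (gamma @` `I_k.+1) (beta @` `I_m.+1)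
    (alpha @` `I_n.+1) x' y' z' (alpha s) (epoint s%:R x' z')
    (side_depth C x z (alpha s)).
  by constructor 3; split; [exists s | exact: segment_comparison sa _ _ _ | ].
have pb : triangle_point C x y z (gamma @` `I_k.+1) (beta @` `I_m.+1)
    (alpha @` `I_n.+1) x' y' z' (beta s) (epoint s%:R y' z')
    (side_depth C y z (beta s)).
  by constructor 2; split; [exists s | exact: segment_comparison sb _ _ _ | ].
have := cat _ _ _ tri _ _ _ _ _ _ pa pb.
have := gauge_le (side_depth_le sa sn); have := gauge_le (side_depth_le sb sm).
have := @edist_epoint2 _ s%:R x' y' z' z' (ler0n _ _).
rewrite xy xz yz edistxx.
by rewrite !mulr0 => /(_ sy sz); lra.
Qed.

(* If kappa vanished at a small eta > 0, the CAT(0) condition would force a long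
   quasi-geodesic to be constant along its points k * eta. *)
Lemma gauge_gt0 x y a : 2 * C < mdist x y -> 0 < a -> 0 < kappa a.
Proof.
move=> Cxy a0; rewrite lt_neqAle gauge_ge0 andbT; apply/eqP => ka.
have C0 := C_gt0.
have [_ _ joined cat0] := hX.
have [l [gamma qg]] := joined x y.
have [l0 g0 gl qgC] := qg.
have lC : C < l.
  have := qgC 0 l; rewrite /= !in_itv/= g0 gl !lexx l0 => /(_ isT isT)/andP[_].
  by rewrite sub0r normrN ger0_norm//; lra.
have sd : is_side C x y (gamma @` `[0, l]%classic) by left; exists l, gamma.
(* The triangle is degenerate, with vertices [x], [y], [y]; this side is a segment of length 0. *)
have sy : is_side C y y ((fun=> y) @` `I_1).
  apply: segment_side; split=> // i j; rewrite /= !ltnS !leqn0 => /eqP-> /eqP->.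
  by rewrite subrr normr0 mdistxx sub0r add0r oppr_le0 (ltW C0).
have [x' [y' [z' tri]]] := comparison_triangle_ex x y y.
have [xy _ _] := tri.
pose eta := Num.min a C.
have eta0 : 0 < eta by rewrite lt_min a0.
have keta b : b <= eta -> kappa b = 0.
  move=> be; apply/eqP; rewrite eq_le gauge_ge0 andbT ka gauge_le//.
  by rewrite (le_trans be)// ge_min lexx.
have step r : 0 <= r -> r + eta <= l -> gamma r = x -> gamma (r + eta) = x.
  move=> r0 rl gr; have r2 : 0 <= r + eta by rewrite addr_ge0// ltW.
  have rl' : r <= l by lra.
  have : mdist (gamma r) (gamma (r + eta)) <= C + eta.
    have := qgC r (r + eta); rewrite /= !in_itv/= r0 rl r2 rl' => /(_ isT isT).
    rewrite opprD addrA subrr sub0r normrN ger0_norm ?(ltW eta0)//.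
    by case/andP; lra.
  rewrite gr => dC.
  have etaC : eta <= C by rewrite ge_min lexx orbT.
  (* The point at distance [C] from [x'] is a comparison point for both [x] and [gamma (r + eta)],
     whose distances to [x] lie in [[0, 2C]]. Both depths are at most [eta], where [kappa] vanishes,
     so the two points coincide. *)
  have in1 : 0 <= C <= edist x' y' by rewrite xy; lra.
  apply/esym/mdist_positivity/eqP; rewrite eq_le mdist_ge0 andbT.
  have pa : triangle_point C x y y (gamma @` `[0, l]%classic)
     ((fun=> y) @` `I_1) (gamma @` `[0, l]%classic) x' y' z' x
     (epoint C x' y') (side_depth C x y x).
    constructor 1; split=> //; first by exists 0 => //=; rewrite in_itv/= lexx.
    split; first exact: epoint_segment.
    by rewrite edist_epoint// mdistxx sub0r normrN gtr0_norm.
  have pb : triangle_point C x y y (gamma @` `[0, l]%classic)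
     ((fun=> y) @` `I_1) (gamma @` `[0, l]%classic) x' y' z' (gamma (r + eta))
     (epoint C x' y') (side_depth C x y (gamma (r + eta))).
    constructor 1; split=> //.
      by exists (r + eta) => //=; rewrite in_itv/= r2.
    split; first exact: epoint_segment.
    rewrite edist_epoint// metric_sym ler_norml.
    by have := mdist_ge0 x (gamma (r + eta)); lra.
  have := cat0 _ _ _ _ _ _ (And3 sd sy sd) _ _ _ tri _ _ _ _ _ _ pa pb.
  rewrite edistxx !keta ?addr0//.
    by rewrite /side_depth lerBlDr ge_min (le_trans dC)// addrC.
  by rewrite /side_depth lerBlDr ge_min mdistxx addr_ge0// ltW.
have const k : k%:R * eta <= l -> gamma (k%:R * eta) = x.
  elim: k => [|k IH]; first by rewrite mul0r.
  rewrite -natr1 mulrDl mul1r => kl; apply: step => //.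
    by rewrite mulr_ge0 ?ler0n// ltW.
  by apply: IH; move: kl; lra.
pose k := Num.truncn (l / eta).
have kl : k%:R * eta <= l < (k.+1)%:R * eta.
  by rewrite -ler_pdivlMr// -ltr_pdivrMr// truncn_itv// divr_ge0// ltW.
case/andP: kl => kl lk.
(* The last multiple of [eta] up to [l] is mapped to [x] and lies within [eta <= C] of [l], so
   [mdist x y <= 2 * C], a contradiction. *)
have := qgC (k%:R * eta) l; rewrite /= !in_itv/= kl !lexx l0 const// gl.
rewrite mulr_ge0 ?ler0n ?(ltW eta0)// => /(_ isT isT)/andP[_].
rewrite distrC ger0_norm ?subr_ge0//.
have etaC : eta <= C by rewrite ge_min lexx orbT.
by move: lk; rewrite -natr1; lra.
Qed.

End Comparison.

(** * Sublinearity: closeness at late times descends to earlier times *)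

Section Divergence.
Context {R : realType} {X : metricType R} (C : R) (kappa : R -> R).
Context (hX : asymptotically_CAT0 X C kappa) (hC : discretely_joined X C).
Implicit Types (a b e : R) (x y z : X) (alpha beta : nat -> X) (m n s t u : nat).

Local Notation C_gt0 := (asymptotic_constant_gt0 hX).

Lemma nat_above a : exists n : nat, a < n%:R.
Proof.
exists (Num.truncn `|a|).+1; apply: le_lt_trans (ler_norm _) _.
by have /andP[] := truncn_itv (normr_ge0 a).
Qed.

Lemma gauge_sublinear (K M e : R) : 0 < e ->
  exists T : nat, forall u, (T <= u)%N -> K * kappa u%:R + M <= e * u%:R.
Proof.
move=> e0; have [_ [k0 _ +] _ _] := hX.
(* Half of [e] pays for the [kappa] term and half for [M]; the [+ 1] covers [K = 0]. *)
pose d := e / (2 * (`|K| + 1)).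
have K0 : 0 < `|K| + 1 by rewrite ltr_wpDl.
have d0 : 0 < d by rewrite divr_gt0// mulr_gt0.
move=> /cvgr0Pnorm_le/(_ d d0)[A [_ Ad]].
pose B := Num.max A (Num.max 1 (2 * `|M| / e)).
have [T BT] := nat_above B; exists T => u Tu.
have Bu : B < u%:R by apply: lt_le_trans BT _; rewrite ler_nat.
have [Au [u1 Mu]] : A < u%:R /\ 1 < (u%:R : R) /\ 2 * `|M| / e < u%:R.
  by move: Bu; rewrite !gt_max => /and3P[].
have u0 : 0 < (u%:R : R) by rewrite (lt_trans ltr01).
have := Ad _ Au; rewrite ger0_norm ?divr_ge0 ?k0 ?(ltW u0)//.
rewrite ler_pdivrMr// /d => ku.
have {}ku : 2 * (`|K| + 1) * kappa u%:R <= e * u%:R.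
  by move: ku; rewrite mulrAC ler_pdivlMr ?mulr_gt0// mulrC.
have : K * kappa u%:R <= `|K| * kappa u%:R by rewrite ler_wpM2r ?k0// ler_norm.
move: Mu; rewrite ltr_pdivrMr// => Mu; have := ler_norm M; have := k0 u%:R.
by lra.
Qed.

Lemma ray_segment n alpha : is_ray C alpha ->
  is_segment C n alpha (alpha 0%N) (alpha n).
Proof. by move=> ra; split=> // s t _ _; exact: ra. Qed.

(** The last hypothesis makes the Euclidean term of [fan_dist] at most [kappa s%:R], the margin
    between 2 and 3 times the gauge. *)
Lemma fan_close n m alpha beta x y z s (L : R) :
  is_segment C n alpha x y -> is_segment C m beta x z ->
  (0 < s)%N -> (s <= n)%N -> (s <= m)%N ->
  s%:R <= L -> L <= mdist x y -> L <= mdist x z ->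
  2 * s%:R * mdist y z <= kappa s%:R * L ->
  mdist (alpha s) (beta s) <= 3 * kappa s%:R.
Proof.
move=> sa sb s0 sn sm sL Ly Lz yz.
have := fan_dist hX hC sa sb sn sm (le_trans sL Ly) (le_trans sL Lz).
suff : 2 * (s%:R / mdist x y * mdist y z) <= kappa s%:R by lra.
have d0 : 0 < mdist x y.
  by apply: lt_le_trans Ly; apply: lt_le_trans sL; rewrite ltr0n.
rewrite mulrAC mulrA mulrA ler_pdivrMr//; apply: le_trans yz _.
by rewrite ler_wpM2l// (gauge_ge0 hX).
Qed.

(* At a large time u the bound K * kappa u + M is negligible against u, so the
   comparison triangle is thin at the fixed time s; the margin between
   2 * kappa s (the CAT(0) defect) and 3 * kappa s absorbs what is left. *)
Lemma agree_down s (K M : R) : exists T : nat, forall u alpha beta x y z,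
  (T <= u)%N -> is_segment C u alpha x y -> is_segment C u beta x z ->
  mdist y z <= K * kappa u%:R + M ->
  (s <= u)%N /\ mdist (alpha s) (beta s) <= 3 * kappa s%:R.
Proof.
have C0 := C_gt0.
have [c cC] := nat_above (4 * C).
have [->|s0] := posnP s.
  exists 0%N => u alpha beta x y z _ [-> _ _] [-> _ _] _; split=> //.
  by rewrite mdistxx mulr_ge0// (gauge_ge0 hX).
(* If all distances are at most [2 * C], no segment has length above [4 * C] and the claim is
   vacuous for late [u]; otherwise [kappa] is positive at [s]. *)
have [[x0 [y0 far]]|bounded] := pselect (exists x y : X, 2 * C < mdist x y); last first.
  exists (c + s)%N => u alpha beta x y z Tu sa; exfalso; apply: bounded.
  exists x, y; have /andP[+ _] := segment_length sa.
  have : (c%:R : R) <= u%:R by rewrite ler_nat (leq_trans _ Tu)// leq_addr.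
  by lra.
have ks := gauge_gt0 hX far (_ : 0 < s%:R); rewrite ltr0n s0 in ks.
have {}ks := ks isT.
have s0' : 0 < (s%:R : R) by rewrite ltr0n.
(* With slope [kappa s / (4 s)], the quantity [2 s * mdist y z] is at most [kappa s * u / 2], hence
   at most [kappa s * (u - C)] because [u > 4 * C]. *)
have [T Tk] := gauge_sublinear K M (divr_gt0 ks (mulr_gt0 (ltr0n R 4) s0')).
exists (T + c + s)%N => u alpha beta x y z Tu sa sb yz.
have su : (s <= u)%N by rewrite (leq_trans _ Tu)// leq_addl.
split=> //.
have cu : (c%:R : R) + s%:R <= u%:R.
  by rewrite -natrD ler_nat (leq_trans _ Tu)// -addnA leq_addl.
have /andP[Ly _] := segment_length sa; have /andP[Lz _] := segment_length sb.
apply: (fan_close sa sb s0 su su _ Ly Lz); first by lra.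
have Tu' : (T <= u)%N by rewrite (leq_trans _ Tu)// -addnA leq_addr.
have := le_trans yz (Tk _ Tu').
rewrite mulrAC ler_pdivlMr ?mulr_gt0// => h.
have : kappa s%:R * (u%:R / 2) <= kappa s%:R * (u%:R - C).
  by rewrite ler_wpM2l ?(gauge_ge0 hX)//; lra.
by lra.
Qed.

(** For fixed [s] the Euclidean term of [fan_dist] at time [u] tends to 0 as [u] grows, leaving only
    the CAT(0) defect. *)
Lemma equiv_rays_close alpha beta s : is_ray C alpha -> is_ray C beta ->
  alpha 0%N = beta 0%N -> ray_equiv alpha beta ->
  mdist (alpha s) (beta s) <= 2 * kappa s%:R.
Proof.
move=> ra rb ab0 ab; have C0 := C_gt0.
have [->|s0] := posnP s.
  by rewrite ab0 mdistxx mulr_ge0// (gauge_ge0 hX).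
have s0' : 0 < (s%:R : R) by rewrite ltr0n.
have [c cC] := nat_above (2 * C).
apply/ler_addgt0Pr => e e0.
have e40 : 0 < e / (4 * s%:R) by rewrite divr_gt0// mulr_gt0.
move: ab => /cvgr0Pnorm_le/(_ _ e40)[N _ Ne].
pose u := (N + c + s)%N.
have Nu : (N <= u)%N by rewrite /u -addnA leq_addr.
have := Ne u Nu; rewrite /=.
have su : (s <= u)%N by rewrite leq_addl.
have cu : (c%:R : R) + s%:R <= u%:R.
  by rewrite -natrD ler_nat /u -addnA leq_addl.
rewrite ger0_norm ?divr_ge0 ?mdist_ge0// ler_pdivrMr; last lra.
rewrite mulrAC ler_pdivlMr ?mulr_gt0// => h.
have sa := ray_segment u ra; have sb := ray_segment u rb.
rewrite -ab0 in sb.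
have /andP[Ly _] := segment_length sa; have /andP[Lz _] := segment_length sb.
have := fan_dist hX hC sa sb su su _ _.
have sy : s%:R <= mdist (alpha 0%N) (alpha u) by lra.
have sz : s%:R <= mdist (alpha 0%N) (beta u) by lra.
move=> /(_ sy sz).
suff : 2 * (s%:R / mdist (alpha 0%N) (alpha u) * mdist (alpha u) (beta u)) <= e.
  by lra.
have d0 : 0 < mdist (alpha 0%N) (alpha u) by lra.
rewrite mulrAC mulrA mulrA ler_pdivrMr//.
have : e * (u%:R / 2) <= e * mdist (alpha 0%N) (alpha u).
  by rewrite ler_wpM2l ?(ltW e0)//; lra.
by lra.
Qed.

End Divergence.

(** If no fibre were in [F], the complements of the finitely many fibres over [S] would all be, and
    would meet the preimage of [S]. *)
Lemma ultra_finite_fiber (T : Type) (X : choiceType) (F : set_system T)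
    (UF : UltraFilter F) (f : T -> X) (S : set X) :
  finite_set S -> F (f @^-1` S) -> exists x, F [set t | f t = x].
Proof.
move=> /finite_fsetP[D ->] FD; apply: contrapT => /forallNP noF.
have Fn x : F (~` [set t | f t = x]).
  by have [/noF|//] := in_ultra_setVsetC [set t | f t = x] UF.
have FF : Filter F by exact: _.
have := @filter_bigI _ _ D (fun x => ~` [set t | f t = x]) F FF (fun x _ => Fn x).
move=> /(filterI FD)/filter_ex[t [/= tD]] /(_ (f t) tD).
by apply.
Qed.

(** * Ultrafilter limits of segments, and change of basepoint for rays *)

Section Limits.
Context {R : realType} {X : metricType R} (C : R) (kappa : R -> R).
Context (hX : asymptotically_CAT0 X C kappa) (hC : discretely_joined X C).
Context (hfin : forall (x : X) (r : R), finite_set (ball x r)).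
Implicit Types (x y z o : X) (alpha beta gamma : nat -> X) (m n s t u : nat).

(** At time [k] the paths stay in a finite ball, so their value is constant on a set of [F]. Any two
    times are realized by a single index, whence the quasi-geodesic inequalities pass to the
    limit. *)
Lemma ultra_limit_ray (T : Type) (F : set_system T) (UF : UltraFilter F)
    (gamma : T -> nat -> X) o :
  (forall k, F [set i | is_segment C k (gamma i) o (gamma i k)]) ->
  exists rho, [/\ is_ray C rho, rho 0%N = o &
                  forall k, F [set i | gamma i k = rho k]].
Proof.
move=> seg.
have /choice[rho rhoP] : forall k, exists x, F [set i | gamma i k = x].
  move=> k; apply: (@ultra_finite_fiber _ _ F UF (gamma^~ k) _
    (hfin o (k%:R + C + 1))).
  apply: filterS (seg k) => i sk /=; rewrite ballEmdist /=.
  by have /andP[_ h] := segment_dist_start sk (leqnn k); lra.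
exists rho; split=> //.
- move=> s t _ _.
  have [i [[_ _ qg] [/= <- <-]]] :=
    filter_ex (filterI (seg (maxn s t)) (filterI (rhoP s) (rhoP t))).
  by apply: qg; rewrite /= ltnS (leq_maxl, leq_maxr).
- by have [i [[<- _ _] /= <-]] := filter_ex (filterI (seg 0%N) (rhoP 0%N)).
Qed.

Lemma ray_equivP alpha beta : ray_equiv alpha beta <->
  forall e, 0 < e -> exists T, forall t, (T <= t)%N ->
    mdist (alpha t) (beta t) <= e * t%:R.
Proof.
split=> [ab e e0|ab].
  (* The successor excludes [t = 0], where division by [t] loses the information. *)
  move: ab => /cvgr0Pnorm_le/(_ _ e0)[N _ Ne]; exists N.+1 => t Nt.
  have t0 : 0 < (t%:R : R) by rewrite ltr0n (leq_trans _ Nt).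
  have := Ne t (ltnW Nt); rewrite /= ger0_norm ?divr_ge0 ?mdist_ge0//.
  by rewrite ler_pdivrMr.
apply/cvgr0Pnorm_le => e e0; have [N Ne] := ab e e0.
exists N.+1 => // t /= Nt; have t0 : 0 < (t%:R : R) by rewrite ltr0n (leq_trans _ Nt).
rewrite ger0_norm ?divr_ge0 ?mdist_ge0// ler_pdivrMr//.
exact/Ne/ltnW.
Qed.

Lemma ray_equiv_refl alpha : ray_equiv alpha alpha.
Proof.
apply/ray_equivP => e e0; exists 0%N => t _.
by rewrite mdistxx mulr_ge0 ?ler0n ?(ltW e0).
Qed.

Lemma ray_equiv_sym alpha beta : ray_equiv alpha beta -> ray_equiv beta alpha.
Proof.
move=> /ray_equivP ab; apply/ray_equivP => e /ab[T Te]; exists T => t.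
by rewrite metric_sym; exact: Te.
Qed.

Lemma ray_equiv_trans beta alpha gamma :
  ray_equiv alpha beta -> ray_equiv beta gamma -> ray_equiv alpha gamma.
Proof.
move=> /ray_equivP ab /ray_equivP bc; apply/ray_equivP => e e0.
have e20 : 0 < e / 2 by rewrite divr_gt0.
have [T Te] := ab _ e20; have [U Ue] := bc _ e20.
exists (maxn T U) => t; rewrite geq_max => /andP[/Te ? /Ue ?].
by have := metric_triangle (alpha t) (beta t) (gamma t); lra.
Qed.

Lemma ray_equiv_of_close alpha beta (K M : R) :
  (forall s, mdist (alpha s) (beta s) <= K * kappa s%:R + M) ->
  ray_equiv alpha beta.
Proof.
move=> ab; apply/ray_equivP => e /(gauge_sublinear hX K M)[T Te].
by exists T => t /Te; exact: le_trans.
Qed.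

(** The ray is a limit of segments from [o] to [gamma n]; [cofan_dist] compares each of them with
    the initial part of [gamma], by a bound independent of [n]. *)
Lemma ray_rebase o gamma : is_ray C gamma -> exists rho,
  [/\ is_ray C rho, rho 0%N = o & forall s,
      mdist (rho s) (gamma s) <= 2 * kappa s%:R + 2 * mdist o (gamma 0%N)].
Proof.
move=> rg; have C0 := asymptotic_constant_gt0 hX.
have /choice[ls /choice[sigma sigmaP]] : forall n, exists l sigma,
  is_segment C l sigma o (gamma n) by move=> n; exact: hC.
have [G [UG GG]] := ultraFilterLemma eventually_filter.
have [D DC] := nat_above (2 * C + mdist o (gamma 0%N)).
(* The delay [D] makes time [k] admissible in [cofan_dist] for both paths ending at [gamma n]. *)
have long k n : (k + D <= n)%N -> [/\ (k <= ls n)%N,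
    k%:R <= mdist o (gamma n) & k%:R <= mdist (gamma 0%N) (gamma n)].
  rewrite -(ler_nat R) natrD => kn.
  have /andP[_ h1] := segment_length (sigmaP n).
  have /andP[h2 _] := segment_length (ray_segment n rg).
  have h3 := metric_triangle (gamma 0%N) o (gamma n).
  rewrite (metric_sym _ o) in h3; have h4 := mdist_ge0 o (gamma 0%N).
  by split; [rewrite -(ler_nat R)| |]; lra.
have Glong k : G [set n | (k + D <= n)%N] by apply: GG; exists (k + D)%N.
have [|rho [rr r0 rhoP]] := @ultra_limit_ray _ G UG sigma o.
  move=> k; apply: filterS (Glong k) => n /= /long[kn _ _].
  exact: segment_sub (sigmaP n) kn.
exists rho; split=> // s.
have [n [/= sn <-]] := filter_ex (filterI (Glong s) (rhoP s)).
have [h1 h2 h3] := long _ _ sn.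
apply: (cofan_dist hX hC (sigmaP n) (ray_segment n rg)) => //.
exact: leq_trans (leq_addr _ _) sn.
Qed.

End Limits.

(** * Uniform structure and compactness of the bordification *)

Section Bordification.
Context {R : realType} {X : metricType R} (C : R) (kappa : R -> R) (o : X).
Context (hX : asymptotically_CAT0 X C kappa) (hC : discretely_joined X C).
Context (hfin : forall (x : X) (r : R), finite_set (ball x r)).
Local Notation Xbar := (bordification C kappa o).
Implicit Types (x y z p : X) (gamma : nat -> X) (m n s t u : nat).
Implicit Types (A B D : Xbar) (xi eta : boundary X C).
Implicit Types (alpha beta : @partial_path R X).

Lemma boundary_class xi :
  exists2 gamma, is_ray C gamma & set_val xi = ray_class C gamma.
Proof. by have [gamma rg xiE] := set_valP xi; exists gamma; rewrite // set_valE. Qed.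

Lemma boundary_memP xi gamma : set_val xi gamma ->
  is_ray C gamma /\
  forall gamma', set_val xi gamma' <-> is_ray C gamma' /\ ray_equiv gamma gamma'.
Proof.
have [gamma0 r0 ->] := boundary_class xi.
move=> [rg eg]; split=> // gamma'; split=> -[rg' eg'].
  by split=> //; apply: ray_equiv_trans eg'; exact: ray_equiv_sym.
by split=> //; apply: ray_equiv_trans eg'.
Qed.

Lemma boundary_eq xi eta gamma gamma' : set_val xi gamma -> set_val eta gamma' ->
  ray_equiv gamma gamma' -> xi = eta.
Proof.
move=> gxi geta gg'; have [_ xiE] := boundary_memP gxi.
have [_ etaE] := boundary_memP geta; apply: val_inj.
apply/seteqP; split=> g; [move=> /xiE | move=> /etaE] => -[rg eg];
  [apply/etaE | apply/xiE]; split=> //.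
  by apply: ray_equiv_trans eg; exact: ray_equiv_sym.
by apply: ray_equiv_trans eg.
Qed.

Lemma boundary_ex gamma : is_ray C gamma -> exists xi, set_val xi gamma.
Proof.
move=> rg; have cl : ray_classes C (ray_class C gamma) by exists gamma.
by exists (SigSub (mem_set cl)); split=> //; exact: ray_equiv_refl.
Qed.

Lemma boundary_nonempty xi : exists gamma, set_val xi gamma.
Proof.
have [gamma rg ->] := boundary_class xi; exists gamma.
by split=> //; exact: ray_equiv_refl.
Qed.

Lemma representatives_ex A : exists alpha, representatives A alpha.
Proof.
case: A => [p|xi].
  by have [n [gamma sg]] := hC o p; exists (Some n, gamma); exists n.
have [gamma gxi] := boundary_nonempty xi.
have [rg xiE] := boundary_memP gxi.
have [rho [rr r0 close]] := ray_rebase hX hC hfin o rg.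
exists (None, rho); split=> //; apply/xiE; split=> //; apply: ray_equiv_sym.
by have := ray_equiv_of_close hX close.
Qed.

Lemma partial_path_dom_le alpha s t : (s <= t)%N ->
  partial_path_dom alpha t -> partial_path_dom alpha s.
Proof.
by case: alpha => -[n|] gamma //= st; rewrite /partial_path_dom/= => /(leq_trans _); apply.
Qed.

Lemma representative_segment A alpha u : representatives A alpha ->
  partial_path_dom alpha u -> is_segment C u alpha.2 o (alpha.2 u).
Proof.
case: A alpha => [p|xi] [l gamma] /=.
  by move=> [n -> sg] un; apply: segment_sub sg _.
by move=> [_ g0 /boundary_memP[rg _]] _; rewrite -g0; exact: ray_segment.
Qed.

(** Segments from [o] to the same point can differ in length by up to [2 * C]; the delay [c] ensures
    that time [s] exists on both and does not exceed the distance to the endpoint. *)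
Lemma representatives_close c A alpha beta s t : 2 * C < c%:R ->
  representatives A alpha -> representatives A beta ->
  partial_path_dom alpha t -> (s + c <= t)%N ->
  partial_path_dom beta s /\
  mdist (alpha.2 s) (beta.2 s) <= 2 * kappa s%:R.
Proof.
have C0 := asymptotic_constant_gt0 hX.
case: A alpha beta => [p|xi] [l gamma] [l' gamma'] /=.
  move=> cC [n -> sg] [n' -> sg']; rewrite /partial_path_dom/= ltnS => tn st.
  have : (s + c <= n)%N by exact: leq_trans tn.
  rewrite -(ler_nat R) natrD => scn.
  have /andP[h1 h2] := segment_length sg; have /andP[h3 h4] := segment_length sg'.
  have sn' : (s <= n')%N by rewrite -(ler_nat R); lra.
  have sn : (s <= n)%N by rewrite -(ler_nat R); lra.
  split; first by rewrite ltnS.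
  have := fan_dist hX hC sg sg' sn sn' _ _.
  by rewrite mdistxx !mulr0 addr0; apply; lra.
move=> _ [-> g0 gxi] [-> g0' gxi'] _ _; split=> //.
have [rg xiE] := boundary_memP gxi; have /xiE[rg' gg'] := gxi'.
by apply: (equiv_rays_close hX hC) => //; rewrite g0.
Qed.

Definition agree t A B := exists alpha beta,
  [/\ representatives A alpha, representatives B beta,
      partial_path_dom alpha t, partial_path_dom beta t &
      mdist (alpha.2 t) (beta.2 t) <= 3 * kappa t%:R].

(** These are the entourages. Equality is added because an interior point has representatives of
    bounded length only, so it does not agree with itself at late times. *)
Definition close n A B := A = B \/ exists2 t, (n <= t)%N & agree t A B.

Lemma close_refl n A : close n A A. Proof. by left. Qed.

Lemma close_sym n A B : close n A B -> close n B A.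
Proof.
case=> [->|[t nt [alpha [beta [ra rb ta tb ab]]]]]; first by left.
by right; exists t => //; exists beta, alpha; split=> //; rewrite metric_sym.
Qed.

Lemma close_le m n A B : (m <= n)%N -> close n A B -> close m A B.
Proof.
move=> mn [->|[t nt ab]]; [by left|right; exists t => //].
exact: leq_trans nt.
Qed.

Lemma agree_of_bound n (K M : R) : exists T, forall u A B alpha beta,
  (T <= u)%N -> representatives A alpha -> representatives B beta ->
  partial_path_dom alpha u -> partial_path_dom beta u ->
  mdist (alpha.2 u) (beta.2 u) <= K * kappa u%:R + M ->
  (n <= u)%N /\ mdist (alpha.2 n) (beta.2 n) <= 3 * kappa n%:R.
Proof.
have [T TP] := agree_down hX hC n K M; exists T => u A B alpha beta Tu ra rb ua ub.
exact: TP Tu (representative_segment ra ua) (representative_segment rb ub).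
Qed.

(** The two agreements may occur at different times and for different representatives of [B]. Both
    are brought down to a common time [u], combined there, and the result is brought down to [n]. *)
Lemma close_comp n : exists m, forall A B D,
  close m A B -> close m B D -> close n A D.
Proof.
have [c cC] := nat_above (2 * C).
(* [8 = 3 + 2 + 3]: two agreements, and the comparison of two representatives of [B]. *)
have [u uP] := agree_of_bound n 8 0.
have [T TP] := agree_of_bound u 3 0.
exists (maxn n (maxn T (u + c))) => A B D AB BD.
case: AB => [->|[t]]; first by apply: close_le BD; exact: leq_maxl.
rewrite !geq_max => /and3P[nt Tt uct].
move=> [alpha [beta [ra rb ta tb ab]]].
case: BD => [<-|[t']].
  by right; exists t => //; exists alpha, beta.
rewrite !geq_max => /and3P[_ Tt' uct'] [beta' [delta [rb' rd tb' td bd]]].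
have [ut abu] : (u <= t)%N /\ mdist (alpha.2 u) (beta.2 u) <= 3 * kappa u%:R.
  by apply: (TP t A B) => //; rewrite addr0.
have [ut' bdu] : (u <= t')%N /\ mdist (beta'.2 u) (delta.2 u) <= 3 * kappa u%:R.
  by apply: (TP t' B D) => //; rewrite addr0.
have [_ bbu] := representatives_close cC rb rb' tb uct.
have ua := partial_path_dom_le ut ta; have ud := partial_path_dom_le ut' td.
have [nu adn] : (n <= u)%N /\ mdist (alpha.2 n) (delta.2 n) <= 3 * kappa n%:R.
  apply: (uP u A D) => //.
  have := metric_triangle (alpha.2 u) (beta.2 u) (delta.2 u).
  have := metric_triangle (beta.2 u) (beta'.2 u) (delta.2 u).
  by lra.
right; exists n => //; exists alpha, delta; split=> //.
  exact: partial_path_dom_le nu ua.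
exact: partial_path_dom_le nu ud.
Qed.

Lemma interior_dom_bounded p alpha t :
  representatives (interior_point C kappa o p) alpha ->
  partial_path_dom alpha t -> t%:R <= mdist o p + C.
Proof.
case: alpha => l gamma [n /= -> sg]; rewrite /partial_path_dom/= ltnS => tn.
have /andP[+ _] := segment_length sg.
by move: tn; rewrite -(ler_nat R); lra.
Qed.

(** An interior point has no representative defined at very late times, which leaves two boundary
    points. Their representatives stay within [7 = 2 + 3 + 2] times the gauge, hence are
    equivalent. *)
Lemma close_separated A B : (forall n, close n A B) -> A = B.
Proof.
move=> AB; apply: contrapT => AneB.
have {}AB n : exists2 t, (n <= t)%N & agree t A B by have [|] := AB n.
case: A B AneB AB => [p|xi] [q|eta] AneB AB.
- have [n np] := nat_above (mdist o p + C).
  have [t] := AB n; rewrite -(ler_nat R) => nt [alpha [beta [ra _ ta _ _]]].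
  by have := interior_dom_bounded ra ta; lra.
- have [n np] := nat_above (mdist o p + C).
  have [t] := AB n; rewrite -(ler_nat R) => nt [alpha [beta [ra _ ta _ _]]].
  by have := interior_dom_bounded ra ta; lra.
- have [n np] := nat_above (mdist o q + C).
  have [t] := AB n; rewrite -(ler_nat R) => nt [alpha [beta [_ rb _ tb _]]].
  by have := interior_dom_bounded rb tb; lra.
apply: AneB; congr inr.
have [alpha0 ra0] := representatives_ex (inr xi).
have [beta0 rb0] := representatives_ex (inr eta).
have [_ _ a0] := ra0; have [_ _ b0] := rb0.
apply: (boundary_eq a0 b0); apply: (ray_equiv_of_close hX (K := 7) (M := 0)) => s.
have [c cC] := nat_above (2 * C).
have [T TP] := agree_of_bound s 3 0.
have [t] := AB (maxn T (s + c)); rewrite geq_max => /andP[Tt sct].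
move=> [alpha [beta [ra rb ta tb ab]]].
have [st abs] : (s <= t)%N /\ mdist (alpha.2 s) (beta.2 s) <= 3 * kappa s%:R.
  by apply: (TP t (inr xi) (inr eta)) => //; rewrite addr0.
have [_ aa0] := representatives_close cC ra ra0 ta sct.
have [_ bb0] := representatives_close cC rb rb0 tb sct.
have := metric_triangle (alpha0.2 s) (alpha.2 s) (beta0.2 s).
have := metric_triangle (alpha.2 s) (beta.2 s) (beta0.2 s).
by rewrite (metric_sym (alpha0.2 s) (alpha.2 s)); lra.
Qed.

Lemma dkappa_ballP A B (r : R) : 0 < r ->
  dkappa_ball A r B <-> A = B \/ exists2 t, r^-1 < t%:R & agree t A B.
Proof.
move=> r0; rewrite /dkappa_ball /= /dkappa.
have [->|AneB] := eqVneq A B; first by split=> _; [left|rewrite lte_fin].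
(* All representatives start at [o], so time 0 always counts and the supremum is not that of an
   empty set; inversion is then order-reversing. *)
have agreement_ge0 alpha beta : representatives A alpha -> representatives B beta ->
    (0 <= agreement kappa alpha beta)%E.
  move=> ra rb; apply: ereal_sup_ubound; exists 0%N => //.
  have start D (delta : @partial_path R X) : representatives D delta ->
      partial_path_dom delta 0 /\ delta.2 0%N = o.
    case: D delta => [p|xi] [l gamma] /=.
      by move=> [n -> [-> _ _]].
    by move=> [-> -> _].
  have [da ao] := start _ _ ra; have [db bo] := start _ _ rb; split=> //.
  by rewrite ao bo mdistxx mulr_ge0// (gauge_ge0 hX).
have ltP alpha beta : representatives A alpha -> representatives B beta ->
    ((agreement kappa alpha beta)^-1 < r%:E)%E =
    ((r^-1)%:E < agreement kappa alpha beta)%E.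
  move=> ra rb; rewrite inve_plt ?inE ?lee_fin ?(ltW r0)//; last exact: agreement_ge0.
  by rewrite inver gt_eqF.
split=> [/ereal_inf_ltP[_ [alpha ra [beta rb <-]]]|[/eqP|[t rt]]].
- rewrite ltP// => /ereal_sup_gtP[_ [t [ta tb ab] <-]]; rewrite lte_fin => rt.
  by right; exists t => //; exists alpha, beta.
- by rewrite (negbTE AneB).
- move=> [alpha [beta [ra rb ta tb ab]]]; apply/ereal_inf_ltP.
  exists (agreement kappa alpha beta)^-1%E; first by exists alpha => //; exists beta.
  rewrite ltP//; apply/ereal_sup_gtP; exists (t%:R)%:E; last by rewrite lte_fin.
  by exists t.
Qed.

Lemma nbhs_closeP A (W : set Xbar) :
  nbhs A W <-> exists n, [set B | close n A B] `<=` W.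
Proof.
have ball_close (B : Xbar) (r : R) : 0 < r ->
    exists n, [set D | close n B D] `<=` dkappa_ball B r.
  move=> r0; have [n nr] := nat_above r^-1; exists n => D BD.
  apply/dkappa_ballP => //; case: BD => [|[t nt BD]]; [by left|right].
  by exists t => //; rewrite (lt_le_trans nr)// ler_nat.
rewrite nbhsE; split=> [[U [oU UA] UW]|[n nW]].
  have [r r0 rU] := oU A UA; have [n nr] := ball_close A r r0.
  by exists n => B /nr/rU/UW.
(* The balls are not known to be open, so the open set is the candidate interior of [W];
   [close_comp] shows that it is open. *)
exists [set B | exists k, [set D | close k B D] `<=` W].
  split; last by exists n.
  move=> B [k kW]; have [m mk] := close_comp k.
  have m0 : 0 < (m.+1%:R^-1 : R) by rewrite invr_gt0 ltr0n.
  exists m.+1%:R^-1 => // D BD; exists m => E DE; apply: kW; apply: mk DE.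
  have [->|[t]] := proj1 (@dkappa_ballP B D _ m0) BD; first by left.
  by rewrite invrK ltr_nat => /ltnW/ltnW mt ag; right; exists t.
by move=> B [k kW]; apply: kW; exact: close_refl.
Qed.

Lemma bordification_hausdorff : hausdorff_space Xbar.
Proof.
move=> A B AB; apply: close_separated => n; have [m mn] := close_comp n.
have [| |D [AD BD]] := AB [set D | close m A D] [set D | close m B D].
- by apply/nbhs_closeP; exists m.
- by apply/nbhs_closeP; exists m.
by apply: mn AD _; exact: close_sym.
Qed.

Lemma bordification_metrizable : metrizable R Xbar.
Proof.
apply: (@metrizable_of_countable_base _ _ close).
- exact: close_refl.
- exact: close_sym.
- exact: close_le.
- exact: close_comp.
- exact: nbhs_closeP.
- exact: bordification_hausdorff.
Qed.

(** Either the chosen representatives become arbitrarily long along the ultrafilter, which then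
    converges to the class of their limit ray, or it concentrates on a finite ball, hence on a
    single interior point. *)
Lemma bordification_compact : compact [set: Xbar].
Proof.
rewrite compact_ultra => F UF _.
have FF : Filter F by exact: _.
have /choice[rep repP] := representatives_ex.
have inf_rep xi k : partial_path_dom (rep (inr xi)) k.
  by have [xE _ _] := repP (inr xi); rewrite /partial_path_dom xE.
have [long|] := pselect (forall k, F [set A | partial_path_dom (rep A) k]).
  have [|rho [rr r0 rhoP]] :=
      @ultra_limit_ray _ _ C hfin _ F UF (fun A => (rep A).2) o.
    by move=> k; apply: filterS (long k) => A; apply: representative_segment.
  have [xi rxi] := boundary_ex rr.
  exists (inr xi); split=> //= W /nbhs_closeP[n nW].
  apply: filterS (filterI (long n) (rhoP n)) => A [/= An Arho]; apply: nW.
  right; exists n => //; exists (None, rho), (rep A); split=> //=.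
  by rewrite Arho mdistxx mulr_ge0// (gauge_ge0 hX).
move=> /existsNP[k shortk].
have {}shortk : F [set A | ~ partial_path_dom (rep A) k].
  by have [] := in_ultra_setVsetC [set A | partial_path_dom (rep A) k] UF.
(* The value at boundary points is a dummy: [shortk] excludes them, their representatives being
   defined at all times. *)
pose f A := if A is inl p then p else o.
have [|p Fp] := @ultra_finite_fiber _ _ F UF f _ (hfin o (k%:R + C + 1)).
  apply: filterS shortk => -[q|xi]; rewrite /f /= ballEmdist /=; last first.
    by move=> /(_ (inf_rep xi k)).
  have [n nE sg] := repP (inl q); rewrite /partial_path_dom nE/= ltnS => /negP.
  rewrite -ltnNge -(ltr_nat R) => nk; have /andP[_ h] := segment_length sg.
  by lra.
exists (inl p); split=> //= W /nbhs_closeP[n nW].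
apply: filterS (filterI Fp shortk) => -[q|xi] /= []; last first.
  by move=> _ /(_ (inf_rep xi k)).
by move=> -> _; apply: nW; left.
Qed.
End Bordification.

(** * Extension of isometries, and smallness of far balls *)

Section Action.
Context {R : realType} {X : metricType R} (C : R) (kappa : R -> R) (o : X).
Context (hX : asymptotically_CAT0 X C kappa) (hC : discretely_joined X C).
Context (hfin : forall (x : X) (r : R), finite_set (ball x r)).
Local Notation Xbar := (bordification C kappa o).
Local Notation close := (@close R X C kappa o).
Implicit Types (x y p : X) (g h : X -> X) (gamma : nat -> X) (n s t u : nat).
Implicit Types (A B : Xbar) (xi eta : boundary X C).

(** The default [xi] makes the map total, as the extension is indexed by all self-maps of [X]; for
    isometries a class as required exists. *)
Definition boundary_map g xi : boundary X C :=
  xget xi [set eta | forall gamma, set_val xi gamma -> set_val eta (g \o gamma)].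

Definition bordification_map g A : Xbar :=
  match A with inl x => inl (g x) | inr xi => inr (boundary_map g xi) end.

Lemma isometry_ray g gamma : isometries X g -> is_ray C gamma ->
  is_ray C (g \o gamma).
Proof. by move=> [_ gd] rg s t _ _; rewrite /= gd; exact: rg. Qed.

Lemma isometry_segment g n gamma x y : isometries X g ->
  is_segment C n gamma x y -> is_segment C n (g \o gamma) (g x) (g y).
Proof.
move=> [_ gd] [<- <- qg]; split=> // s t sn tn; rewrite /= gd.
exact: qg.
Qed.

Lemma isometry_ray_equiv g gamma gamma' : isometries X g ->
  ray_equiv gamma gamma' -> ray_equiv (g \o gamma) (g \o gamma').
Proof.
move=> [_ gd] /ray_equivP gg'; apply/ray_equivP => e /gg'[T Te]; exists T => t.
by rewrite /= gd; exact: Te.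
Qed.

Lemma boundary_mapP g xi gamma : isometries X g -> set_val xi gamma ->
  set_val (boundary_map g xi) (g \o gamma).
Proof.
move=> ig; rewrite /boundary_map; case: xgetP => [eta _|noeta]; first exact.
have [gamma0 g0xi] := boundary_nonempty xi.
have [r0 xiE] := boundary_memP g0xi.
have [eta geta] := boundary_ex (isometry_ray ig r0).
have [_ etaE] := boundary_memP geta.
exfalso; apply: (noeta eta) => gamma' /xiE[r' e']; apply/etaE.
by split; [exact: isometry_ray | exact: isometry_ray_equiv].
Qed.

Lemma boundary_mapE g xi eta gamma : isometries X g -> set_val xi gamma ->
  set_val eta (g \o gamma) -> boundary_map g xi = eta.
Proof.
move=> ig gxi geta; apply: boundary_eq (boundary_mapP ig gxi) geta _.
by have := ray_equiv_refl (g \o gamma).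
Qed.

Lemma isometry_id : isometries X id.
Proof. by split=> //; exists id. Qed.

Lemma isometry_comp g h : isometries X g -> isometries X h ->
  isometries X (g \o h).
Proof.
by move=> [bg gd] [bh hd]; split=> [|x y /=]; [exact: bij_comp|rewrite gd hd].
Qed.

Lemma bordification_map_id : bordification_map id = id.
Proof.
apply/funext => -[x|xi] //=; congr inr.
have [gamma gxi] := boundary_nonempty xi.
exact: (boundary_mapE isometry_id gxi).
Qed.

Lemma bordification_map_comp g h : isometries X g -> isometries X h ->
  bordification_map (g \o h) = bordification_map g \o bordification_map h.
Proof.
move=> ig ih; apply/funext => -[x|xi] //=; congr inr.
have [gamma gxi] := boundary_nonempty xi.
apply: (boundary_mapE (isometry_comp ig ih) gxi).
exact: (boundary_mapP ig (boundary_mapP ih gxi)).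
Qed.

(** The image of a path from [o] starts at [g o]. Rebasing it at [o] costs the error of [cofan_dist]
    for segments or of [ray_rebase] for rays; [c] absorbs the change in length. *)
Lemma representative_map g c A alpha : isometries X g ->
  2 * C + mdist o (g o) < c%:R -> representatives A alpha ->
  exists2 sigma, representatives (bordification_map g A) sigma &
    forall s t, partial_path_dom alpha t -> (s + c <= t)%N ->
      partial_path_dom sigma s /\
      mdist (sigma.2 s) (g (alpha.2 s)) <= 2 * kappa s%:R + 2 * mdist o (g o).
Proof.
have C0 := asymptotic_constant_gt0 hX; have D0 := mdist_ge0 o (g o).
move=> ig cC; case: A alpha => [p|xi] [l gamma] /=.
  move=> [n -> sg]; have [m [sigma ss]] := hC o (g p).
  exists (Some m, sigma); first by exists m.
  move=> s t; rewrite /partial_path_dom/= ltnS => tn st.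
  have : (s + c <= n)%N by exact: leq_trans tn.
  rewrite -(ler_nat R) natrD => scn.
  have sg' := isometry_segment ig sg.
  have /andP[h1 h2] := segment_length ss; have /andP[h3 h4] := segment_length sg'.
  have h5 := metric_triangle (g o) o (g p); rewrite (metric_sym (g o) o) in h5.
  have sm : (s <= m)%N by rewrite -(ler_nat R); lra.
  have sn : (s <= n)%N by rewrite -(ler_nat R); lra.
  split; first by rewrite ltnS.
  by apply: (cofan_dist hX hC ss sg' sm sn); lra.
move=> [-> g0 gxi]; have [rg _] := boundary_memP gxi.
have [rho [rr r0 rclose]] := ray_rebase hX hC hfin o (isometry_ray ig rg).
exists (None, rho) => /=.
  split=> //; have [_ mapE] := boundary_memP (boundary_mapP ig gxi).
  apply/mapE; split=> //; apply: ray_equiv_sym.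
  by have := ray_equiv_of_close hX rclose.
by move=> s t _ _; split=> //; have := rclose s; rewrite /= g0.
Qed.

Lemma bordification_map_close g n : isometries X g -> exists m, forall A B,
  close m A B -> close n (bordification_map g A) (bordification_map g B).
Proof.
move=> ig; have [c cC] := nat_above (2 * C + mdist o (g o)).
have [_ gd] := ig.
(* [7 = 2 + 3 + 2] and [4 = 2 + 2]: one agreement and two rebasings. *)
have [u uP] := agree_of_bound o hX hC n 7 (4 * mdist o (g o)).
have [T TP] := agree_of_bound o hX hC u 3 0.
exists (maxn T (u + c)) => A B [->|[t]]; first by left.
rewrite geq_max => /andP[Tt uct] [alpha [beta [ra rb ta tb ab]]].
have [ut abu] : (u <= t)%N /\ mdist (alpha.2 u) (beta.2 u) <= 3 * kappa u%:R.
  by apply: (TP t A B) => //; rewrite addr0.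
have [sigma rs /(_ u t ta uct)[us sa]] := representative_map ig cC ra.
have [tau rt /(_ u t tb uct)[ut' tb']] := representative_map ig cC rb.
have [nu st] : (n <= u)%N /\ mdist (sigma.2 n) (tau.2 n) <= 3 * kappa n%:R.
  apply: (uP u _ _ _ _ (leqnn u) rs rt) => //.
  have := metric_triangle (sigma.2 u) (g (alpha.2 u)) (tau.2 u).
  have := metric_triangle (g (alpha.2 u)) (g (beta.2 u)) (tau.2 u).
  by rewrite gd (metric_sym (g (beta.2 u)) (tau.2 u)); lra.
right; exists n => //; exists sigma, tau; split=> //.
  exact: partial_path_dom_le nu us.
exact: partial_path_dom_le nu ut'.
Qed.

Lemma isometries_extend_bordification : isometries_extend C kappa o.
Proof.
exists bordification_map; split=> //.
- exact: bordification_map_id.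
- exact: bordification_map_comp.
- move=> g ig A W /(nbhs_closeP hX hC)[n nW].
  have [m mn] := bordification_map_close n ig.
  by apply/(nbhs_closeP hX hC); exists m => B /mn/nW.
Qed.

(** Otherwise a sequence of counterexamples clusters at some [A]; a late term near [A] has its whole
    entourage inside a member of the cover containing [A]. *)
Lemma lebesgue_number (UU : set (set Xbar)) : open_cover UU ->
  exists n, forall A, cover_small UU [set B | close n A B].
Proof.
move=> [oUU cUU]; apply: contrapT => /forallNP nosmall.
have /choice[a aP] : forall n, exists A, ~ cover_small UU [set B | close n A B].
  by move=> n; apply/existsNP; exact: nosmall.
have cpt := bordification_compact (o := o) hX hC hfin.
have [A [_ Acl]] := cpt (a @ \oo) _ filterT.
have [U UUU UA] : (\bigcup_(U in UU) U) A by rewrite cUU.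
have /(nbhs_closeP hX hC)[n nU] : nbhs A U by apply: open_nbhs_nbhs; split=> //; exact: oUU.
have [m mn] := close_comp o hX hC n.
have [||_ [[k mk <-] Aak]] := Acl (a @` [set k | (m <= k)%N]) [set B | close m A B].
- by exists m => // k /= mk; exists k.
- by apply/(nbhs_closeP hX hC); exists m.
apply: (aP k); exists U => // B akB; apply: nU; apply: mn Aak _.
exact: close_le akB.
Qed.

(** Seen from [o], two points at distance less than [r] subtend a small angle when far away, so
    segments to them are still close at time [n]. *)
Lemma ball_close n (r : R) : 0 < r -> exists L : R, forall x y,
  L <= mdist o x -> mdist x y < r ->
  close n (interior_point C kappa o x) (interior_point C kappa o y).
Proof.
move=> r0; have C0 := asymptotic_constant_gt0 hX.
have [->|n0] := posnP n.
  exists 0 => x y _ _; right; exists 0%N => //.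
  have [a [alpha sa]] := hC o x; have [b [beta sb]] := hC o y.
  exists (Some a, alpha), (Some b, beta); split=> //; [by exists a|by exists b|].
  rewrite /=; have [-> _ _] := sa; have [-> _ _] := sb.
  by rewrite mdistxx mulr_ge0// (gauge_ge0 hX).
have [[x0 [y0 far]]|bounded] := pselect (exists x y : X, 2 * C < mdist x y); last first.
  exists (2 * C + 1) => x y ox _; exfalso; apply: bounded; exists o, x; lra.
have kn : 0 < kappa n%:R by apply: (gauge_gt0 hX far); rewrite ltr0n.
(* The smallest [L] with [2 n r <= kappa n * L], as [fan_close] demands; the terms [n + C + r] below
   make both segments long enough. *)
pose q := 2 * n%:R * r / kappa n%:R.
have q0 : 0 <= q by rewrite divr_ge0 ?mulr_ge0 ?(ltW r0) ?(ltW kn)// ler0n.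
exists (n%:R + C + r + q) => x y ox xy; right; exists n => //.
have [a [alpha sa]] := hC o x; have [b [beta sb]] := hC o y.
have /andP[_ ha] := segment_length sa; have /andP[_ hb] := segment_length sb.
have oy := metric_triangle o y x; rewrite (metric_sym y) in oy.
have na : (n <= a)%N by rewrite -(ler_nat R); lra.
have nb : (n <= b)%N by rewrite -(ler_nat R); lra.
exists (Some a, alpha), (Some b, beta); split=> //; [by exists a|by exists b|].
apply: (fan_close hX hC sa sb n0 na nb (L := mdist o x - r)); [lra|lra|lra|].
have qE : kappa n%:R * q = 2 * n%:R * r by rewrite mulrC divfK// gt_eqF.
have : 2 * n%:R * mdist x y <= 2 * n%:R * r.
  by rewrite ler_wpM2l ?mulr_ge0 ?ler0n// ltW.
move=> /le_trans; apply; rewrite -qE ler_wpM2l ?(ltW kn)//.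
have := ler0n R n; lra.
Qed.

(** A ball that is not small has its centre within [L] of [o], and there are finitely many such
    centres. *)
Lemma interior_balls_small (r : R) (UU : set (set Xbar)) : 0 < r ->
  open_cover UU -> finite_set (interior_balls C kappa o r `\` cover_small UU).
Proof.
move=> r0 /lebesgue_number[n nUU]; have [L LP] := ball_close n r0.
apply: (@sub_finite_set _ _
  ((fun x => interior_point C kappa o @` ball x r) @` ball o L)); last first.
  exact/finite_image/hfin.
move=> _ [[x _ <-] nosmall]; exists x => //; rewrite ballEmdist /= ltNge.
apply/negP => Lx; apply: nosmall.
have [U UUU closeU] := nUU (interior_point C kappa o x).
exists U => // _ [y + <-]; rewrite ballEmdist => xy; apply: closeU.
exact: (LP x y Lx xy).
Qed.

End Action.

Theorem theorem5p13 (R : realType) (X : metricType R) (C : R) (kappa : R -> R)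
    (o : X) (hX : asymptotically_CAT0 X C kappa) (hC : discretely_joined X C)
    (hfin : forall (x : X) (r : R), finite_set (ball x r)) :
  [/\ compact [set: bordification C kappa o],
      hausdorff_space (bordification C kappa o),
      metrizable R (bordification C kappa o),
      isometries_extend C kappa o &
      forall (r : R) (UU : set (set (bordification C kappa o))),
        0 < r -> open_cover UU ->
        finite_set (interior_balls C kappa o r `\` cover_small UU)].
Proof.
split.
- exact: bordification_compact.
- exact: bordification_hausdorff.
- exact: bordification_metrizable.
- exact: isometries_extend_bordification.
- exact: interior_balls_small.
Qed.
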